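(* If $G$ and $H$ are graphs, then $$M(G\boxtimes H;x,y)=M^{(G)}(x,y)+M^{(H)}(x,y)+M^{(\times)}(x,y),$$ where $$M^{(G)}(x,y)=\sum_{j}\sum_{i_1\le i_2} n_j(H)\,m_{i_1,i_2}(G)\,x^{\min(d_1,d_2)}y^{\max(d_1,d_2)},$$ with $d_1=i_1+j+i_1j$ and $d_2=i_2+j+i_2j$; $$M^{(H)}(x,y)=\sum_{i}\sum_{j_1\le j_2} n_i(G)\,m_{j_1,j_2}(H)\,x^{\min(e_1,e_2)}y^{\max(e_1,e_2)},$$ with $e_1=i+j_1+ij_1$ and $e_2=i+j_2+ij_2$; and $$M^{(\times)}(x,y)=\sum_{\substack{i_1\le i_2\\ j_1\le j_2}} m_{i_1,i_2}(G)\,m_{j_1,j_2}(H)\Bigl(x^{\min(f_{11},f_{22})}y^{\max(f_{11},f_{22})}+x^{\min(f_{12},f_{21})}y^{\max(f_{12},f_{21})}\Bigr),$$ with $f_{ab}=i_a+j_b+i_aj_b$ for $a,b\in\{1,2\}$.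
   Context: All graphs are finite, simple, and undirected. For a graph $G$, $\deg_G(g)$ denotes the degree of $g\in V(G)$. For $i\ge 0$ let $n_i(G)=|\{g\in V(G): \deg_G(g)=i\}|$, and for $i\le j$ let $m_{i,j}(G)=|\{\{g,g'\}\in E(G): \{\deg_G(g),\deg_G(g')\}=\{i,j\}\}|$. The M-polynomial of $G$ is $M(G;x,y)=\sum_{i\le j} m_{i,j}(G)\,x^iy^j$. The strong product $G\boxtimes H$ has vertex set $V(G)\times V(H)$; vertices $(g_1,h_1)$ and $(g_2,h_2)$ are adjacent if $g_1=g_2$ and $h_1h_2\in E(H)$, or $h_1=h_2$ and $g_1g_2\in E(G)$, or $g_1g_2\in E(G)$ and $h_1h_2\in E(H)$. In the sums, indices $i,i_1,i_2$ range over vertex degrees of $G$ and $j,j_1,j_2$ over vertex degrees of $H$. *)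

(* Defs.v *)
From HB Require Import structures.
From mathcomp Require Import all_boot all_order all_algebra.
From mathcomp Require Import mpoly.

Set Implicit Arguments.
Unset Strict Implicit.
Unset Printing Implicit Defensive.

Import GRing.Theory.
Local Open Scope ring_scope.

Record sgraph := SGraph {
  vertex :> finType;
  adj : rel vertex;
  adj_sym : ssrbool.symmetric adj;
  adj_irrefl : irreflexive adj }.

Definition edges (G : sgraph) : {set {set G}} :=
  [set [set p.1; p.2] | p : G * G & adj p.1 p.2].

Definition deg (G : sgraph) (g : G) : nat := #|[set g' : G | adj g g']|.

Definition degrees (G : sgraph) : seq nat := undup [seq deg g | g : G].

Definition ndeg (G : sgraph) (i : nat) : nat := #|[set g : G | deg g == i]|.

Definition medge (G : sgraph) (i j : nat) : nat :=
  #|[set e in edges G |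
      [exists g : G, exists g' : G,
        (e == [set g; g']) && perm_eq [:: deg g; deg g'] [:: i; j]]]|.

Definition vx : {mpoly int[2]} := 'X_ord0.
Definition vy : {mpoly int[2]} := 'X_ord_max.

(* The sum over all i <= j may be restricted to degrees of G, because
   medge G i j = 0 unless i and j are both degrees of G. *)
Definition Mpoly (G : sgraph) : {mpoly int[2]} :=
  \sum_(i <- degrees G) \sum_(j <- degrees G | (i <= j)%N)
    (medge G i j)%:R * (vx ^+ i * vy ^+ j).

Section StrongProduct.
Variables G H : sgraph.

Definition strong_adj : rel (G * H) := fun u v =>
  [|| (u.1 == v.1) && adj u.2 v.2,
      (u.2 == v.2) && adj u.1 v.1
    | adj u.1 v.1 && adj u.2 v.2].

Lemma strong_adj_sym : ssrbool.symmetric strong_adj.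
Proof.
move=> u v; rewrite /strong_adj (eq_sym u.1) (eq_sym u.2).
by rewrite (adj_sym u.1) (adj_sym u.2).
Qed.

Lemma strong_adj_irrefl : irreflexive strong_adj.
Proof. by move=> u; rewrite /strong_adj !adj_irrefl !andbF. Qed.

Definition strong_product : sgraph := SGraph strong_adj_sym strong_adj_irrefl.

Definition Mpoly_G : {mpoly int[2]} :=
  \sum_(j <- degrees H)
  \sum_(i1 <- degrees G) \sum_(i2 <- degrees G | (i1 <= i2)%N)
    let d1 := (i1 + j + i1 * j)%N in
    let d2 := (i2 + j + i2 * j)%N in
    (ndeg H j)%:R * (medge G i1 i2)%:R *
      (vx ^+ minn d1 d2 * vy ^+ maxn d1 d2).

Definition Mpoly_H : {mpoly int[2]} :=
  \sum_(i <- degrees G)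
  \sum_(j1 <- degrees H) \sum_(j2 <- degrees H | (j1 <= j2)%N)
    let e1 := (i + j1 + i * j1)%N in
    let e2 := (i + j2 + i * j2)%N in
    (ndeg G i)%:R * (medge H j1 j2)%:R *
      (vx ^+ minn e1 e2 * vy ^+ maxn e1 e2).

Definition Mpoly_cross : {mpoly int[2]} :=
  \sum_(i1 <- degrees G) \sum_(i2 <- degrees G | (i1 <= i2)%N)
  \sum_(j1 <- degrees H) \sum_(j2 <- degrees H | (j1 <= j2)%N)
    let f11 := (i1 + j1 + i1 * j1)%N in
    let f12 := (i1 + j2 + i1 * j2)%N in
    let f21 := (i2 + j1 + i2 * j1)%N in
    let f22 := (i2 + j2 + i2 * j2)%N in
    (medge G i1 i2)%:R * (medge H j1 j2)%:R *
      (vx ^+ minn f11 f22 * vy ^+ maxn f11 f22 +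
       vx ^+ minn f12 f21 * vy ^+ maxn f12 f21).

End StrongProduct.

(* Main.v *)
Require Import Defs.
From mathcomp Require Import all_boot all_order all_algebra.
From mathcomp Require Import mpoly.
Local Open Scope ring_scope.

(** For a function [F] that is symmetric in two degrees, twice the sum of
    [F] over the edges of a graph is its sum over the ordered adjacent pairs.
    The ordered adjacent pairs of the strong product split into three disjoint
    classes: first coordinates equal, second coordinates equal, both adjacent.
    Doubling the identity once for each factor turns every term into a sum over
    ordered pairs, and the final factor 4 is cancelled because polynomials over
    the integers have characteristic zero. *)

Import GRing.Theory.

Lemma perm_eq_pair (T : eqType) (a b c d : T) :
  perm_eq [:: a; b] [:: c; d] = ((a == c) && (b == d)) || ((a == d) && (b == c)).
Proof.
apply/idP/orP => [H|[] /andP[/eqP-> /eqP->] //]; last first.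
  by apply/permP => p /=; rewrite !addn0 addnC.
have := perm_mem H a; rewrite !inE eqxx /= => /esym/orP[] /eqP eq_a; subst a.
- by left; move: H; rewrite perm_cons => /perm_mem/(_ b); rewrite !inE !eqxx => /esym ->.
- right; rewrite eqxx /=.
  have: perm_eq [:: d; b] [:: d; c].
    by apply: (perm_trans H); apply/permP => p /=; rewrite !addn0 addnC.
  by rewrite perm_cons => /perm_mem/(_ b); rewrite !inE !eqxx => /esym ->.
Qed.

Lemma set2_eq (T : finType) (a b c d : T) :
  ([set a; b] == [set c; d]) = ((a == c) && (b == d)) || ((a == d) && (b == c)).
Proof.
apply/eqP/orP => [/setP E|[] /andP[/eqP-> /eqP->] //]; last by rewrite setUC.
have /orP[/eqP eq_a|/eqP eq_a] : (a == c) || (a == d).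
    by have := E a; rewrite !inE eqxx.
- subst a; left; rewrite eqxx; have := E b; have := E d; rewrite !inE !eqxx !orbT /=.
  by move=> H /esym/orP[/eqP eq_b|//]; move: H; rewrite eq_b orbb eq_sym.
- subst a; right; rewrite eqxx; have := E b; have := E c; rewrite !inE !eqxx !orbT /=.
  by move=> H /esym/orP[//|/eqP eq_b]; move: H; rewrite eq_b orbb eq_sym.
Qed.

(** [medge] asks for some naming of the endpoints of an edge; the degree test is invariant under
    swapping them, so any one naming decides it. *)
Lemma edge_degP (G : sgraph) (g h : G) i j :
  [exists a : G, exists b : G,
     ([set g; h] == [set a; b]) && perm_eq [:: deg a; deg b] [:: i; j]]
  = perm_eq [:: deg g; deg h] [:: i; j].
Proof.
apply/existsP/idP => [[a /existsP[b /andP[]]]|H]; last first.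
  by exists g; apply/existsP; exists h; rewrite eqxx.
rewrite set2_eq => /orP[] /andP[/eqP-> /eqP->] //.
by rewrite !perm_eq_pair => /orP[] /andP[-> ->]; rewrite ?orbT.
Qed.

(** The fibre of [p |-> [set p.1; p.2]] over an edge [[set a; b]] is [(a, b)] and [(b, a)], distinct
    by irreflexivity. *)
Lemma sum_edges (G : sgraph) (V : nmodType) (K : {set G} -> V) :
  (\sum_(e in edges G) K e) *+ 2
  = \sum_(p : G * G | adj p.1 p.2) K [set p.1; p.2].
Proof.
rewrite (partition_big (fun p : G * G => [set p.1; p.2]) (mem (edges G))) /=; last first.
  by move=> p ap; apply/imsetP; exists p; rewrite ?inE.
rewrite -sumrMnl; apply: eq_bigr => e /imsetP[[a b]]; rewrite inE /= => ab -> {e}.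
rewrite (eq_bigl (mem [set (a, b); (b, a)])) => [|[c d]]; last first.
  rewrite /= !inE set2_eq !xpair_eqE andb_orr.
  have ba : adj b a by rewrite adj_sym.
  by do !case: eqP => ? //=; subst; rewrite ?andbF ?ab ?ba.
rewrite big_setU1 ?big_set1 /=; first by rewrite (setUC [set b]) mulr2n.
rewrite inE xpair_eqE; apply/negP => /andP[/eqP eq_ab _].
by rewrite eq_ab adj_irrefl in ab.
Qed.

Section DegreeSums.
Variables (G : sgraph) (R : nzRingType).

Lemma mem_degrees (g : G) : deg g \in degrees G.
Proof. by rewrite mem_undup; apply/mapP; exists g; rewrite ?mem_enum. Qed.

Lemma big_degrees_pred1 (g : G) (f : nat -> R) :
  \sum_(i <- degrees G) (deg g == i)%:R * f i = f (deg g).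
Proof.
rewrite (bigD1_seq (deg g)) ?undup_uniq ?mem_degrees //= eqxx mul1r big1 ?addr0 //.
by move=> i /negPf; rewrite eq_sym => ->; rewrite mul0r.
Qed.

Lemma sum_ndeg (f : nat -> R) :
  \sum_(i <- degrees G) (ndeg G i)%:R * f i = \sum_(g : G) f (deg g).
Proof.
under eq_bigr => i _.
  rewrite /ndeg -sum1dep_card natr_sum big_distrl /= big_mkcond /=.
  under eq_bigr => g _.
    rewrite (_ : (if _ then _ else _) = (deg g == i)%:R * f i); last first.
      by case: eqP; rewrite ?mul1r ?mul0r.
    over.
  over.
by rewrite exchange_big /=; apply: eq_bigr => g _; rewrite big_degrees_pred1.
Qed.

Variable F : nat -> nat -> R.
Hypothesis F_sym : forall i j, F i j = F j i.

(** The constraint [i <= j] selects only the sorted ordering of the two degrees, and the symmetry of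
    [F] makes that choice harmless. *)
Lemma sum_perm_eq_degrees (g h : G) :
  \sum_(i <- degrees G) \sum_(j <- degrees G | (i <= j)%N)
    (perm_eq [:: deg g; deg h] [:: i; j])%:R * F i j = F (deg g) (deg h).
Proof.
wlog le_gh : g h / (deg g <= deg h)%N => [H|].
  case/orP: (leq_total (deg g) (deg h)) => [/H //|/H E].
  rewrite F_sym -E; apply: eq_bigr => i _; apply: eq_bigr => j _.
  by rewrite !perm_eq_pair orbC ![_ && (deg h == _)]andbC.
transitivity (\sum_(i <- degrees G) (deg g == i)%:R * F i (deg h)); last first.
  by rewrite (big_degrees_pred1 g (fun i => F i (deg h))).
apply: eq_bigr => i _.
rewrite -(big_degrees_pred1 h (F i)) big_distrr big_mkcond /=.
apply: eq_bigr => j _; rewrite mulrA -natrM mulnb perm_eq_pair.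
case: leqP => [le_ij|lt_ji]; last first.
  case: eqP => [eg|]; case: eqP => [eh|] //=; rewrite ?mul0r //.
  by move: lt_ji; rewrite -eg -eh ltnNge le_gh.
(* A swapped match, together with [deg g <= deg h] and [i <= j], forces [i = j], so it is not
   counted twice. *)
have [/andP[/eqP eg /eqP eh]|] := boolP ((deg g == j) && _); last by rewrite orbF.
have eij : i = j by apply/eqP; rewrite eqn_leq le_ij -eg -eh.
by rewrite eg eh eij eqxx.
Qed.

Lemma sum_medge :
  (\sum_(i <- degrees G) \sum_(j <- degrees G | (i <= j)%N)
     (medge G i j)%:R * F i j) *+ 2
  = \sum_(p : G * G | adj p.1 p.2) F (deg p.1) (deg p.2).
Proof.
pose B (e : {set G}) i j := [exists a : G, exists b : G,
  (e == [set a; b]) && perm_eq [:: deg a; deg b] [:: i; j]].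
transitivity ((\sum_(e in edges G) \sum_(i <- degrees G)
    \sum_(j <- degrees G | (i <= j)%N) (B e i j)%:R * F i j) *+ 2).
  (* [medge G i j] is the sum over all edges of the indicator [B e i j]. *)
  congr (_ *+ 2); rewrite exchange_big /=; apply: eq_bigr => i _.
  rewrite exchange_big /=; apply: eq_bigr => j _.
  rewrite -mulr_suml -natr_sum; congr (_%:R * _).
  rewrite /medge -sum1_card big_mkcond [RHS]big_mkcond /=.
  by apply: eq_bigr => e _; rewrite inE -/(B e i j); case: (e \in _); case: (B e i j).
rewrite sum_edges; apply: eq_bigr => p _; rewrite -sum_perm_eq_degrees.
by apply: eq_bigr => i _; apply: eq_bigr => j _; rewrite /B edge_degP.
Qed.

End DegreeSums.

Lemma big_adj_flip (G : sgraph) (V : nmodType) (f : G -> G -> V) :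
  \sum_(p : G * G | adj p.1 p.2) f p.2 p.1
  = \sum_(p : G * G | adj p.1 p.2) f p.1 p.2.
Proof.
rewrite [RHS](reindex_inj (h := fun p : G * G => (p.2, p.1))) /=; last first.
  by move=> [a b] [c d] /= [-> ->].
by apply: eq_bigl => p; rewrite adj_sym.
Qed.

(* The closed neighbourhood of a vertex of the product is the product of the
   closed neighbourhoods of its coordinates. *)
Lemma deg_strong_product (G H : sgraph) (u : strong_product G H) :
  deg u = (deg u.1 + deg u.2 + deg u.1 * deg u.2)%N.
Proof.
pose N (K : sgraph) (x : K) := x |: [set y | adj x y].
have cardN (K : sgraph) (x : K) : #|N K x| = (deg x).+1.
  by rewrite cardsU1 inE adj_irrefl.
have eN : N _ u = setX (N _ u.1) (N _ u.2).
  case: u => g h; apply/setP => [[g' h']]; rewrite !inE /= /strong_adj xpair_eqE /=.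
  rewrite [g' == g]eq_sym [h' == h]eq_sym.
  by do !case: (_ == _); do !case: (adj _ _).
(* [E] reads [(deg u.1 + 1) * (deg u.2 + 1) = deg u + 1]. *)
have := cardN _ u; rewrite eN cardsX !cardN => E.
by apply: succn_inj; rewrite -E mulSn mulnS addSn addnCA addnA.
Qed.

(** Regrouping two product vertices into a pair from [G] and a pair from [H] turns adjacency into
    conditions on each pair; irreflexivity makes the three cases exclusive. *)
Lemma sum_strong_adj (G H : sgraph) (V : nmodType) (f : G -> H -> G -> H -> V) :
  \sum_(p : strong_product G H * strong_product G H | adj p.1 p.2)
     f p.1.1 p.1.2 p.2.1 p.2.2
  = \sum_(h : H) \sum_(p : G * G | adj p.1 p.2) f p.1 h p.2 h
  + \sum_(g : G) \sum_(q : H * H | adj q.1 q.2) f g q.1 g q.2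
  + \sum_(p : G * G | adj p.1 p.2) \sum_(q : H * H | adj q.1 q.2)
      f p.1 q.1 p.2 q.2.
Proof.
pose s (a : (G * G) * (H * H)) : (G * H) * (G * H) :=
  ((a.1.1, a.2.1), (a.1.2, a.2.2)).
have s_bij : bijective s.
  by exists (fun b => ((b.1.1, b.2.1), (b.1.2, b.2.2))) => [[[a b] [c d]]|[[a b] [c d]]].
rewrite (reindex s) /=; last exact: onW_bij.
(* Vertex sums become sums over diagonal pairs, so that all four sums share one index type and can
   be compared term by term. *)
have diag (K : sgraph) (k : K -> K -> V) :
    \sum_(x : K) k x x = \sum_(p : K * K | p.1 == p.2) k p.1 p.2.
  rewrite -(pair_big_dep xpredT (fun x y : K => x == y) k) /=.
  by apply: eq_bigr => x _; rewrite (eq_bigl (pred1 x)) ?big_pred1_eq // => y; rewrite /= eq_sym.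
rewrite (diag H (fun h h' => \sum_(p | adj p.1 p.2) f p.1 h p.2 h')).
rewrite (diag G (fun g g' => \sum_(q | adj q.1 q.2) f g q.1 g' q.2)).
rewrite exchange_big /= !pair_big_dep /=.
rewrite big_mkcond [X in _ = X + _ + _]big_mkcond [X in _ = _ + X + _]big_mkcond.
rewrite [X in _ = _ + X]big_mkcond -!big_split /=.
apply: eq_bigr => [[[a b] [c d]]] _; rewrite /strong_adj /=.
case: (a =P b) => [->|_]; case: (c =P d) => [->|_]; rewrite ?adj_irrefl /=;
  by do ?case: (adj _ _); rewrite /= ?addr0 ?add0r.
Qed.

Section StrongProductMpoly.
Variables G H : sgraph.

(** Using [minn] and [maxn] makes the monomial symmetric, as [sum_medge] requires. *)
Let F (i j : nat) : {mpoly int[2]} := vx ^+ minn i j * vy ^+ maxn i j.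
Let F_sym i j : F i j = F j i.
Proof. by rewrite /F minnC maxnC. Qed.
(** The degree of a product vertex whose coordinates have degrees [i] and [j]. *)
Let c (i j : nat) := (i + j + i * j)%N.

Lemma Mpoly2 (K : sgraph) :
  Mpoly K *+ 2 = \sum_(p : K * K | adj p.1 p.2) F (deg p.1) (deg p.2).
Proof.
rewrite -(sum_medge _ _ F) //; congr (_ *+ 2).
apply: eq_bigr => i _; apply: eq_bigr => j le_ij.
by rewrite /F (minn_idPl le_ij) (maxn_idPr le_ij).
Qed.

Lemma Mpoly_G2 :
  Mpoly_G G H *+ 2 = \sum_(h : H) \sum_(p : G * G | adj p.1 p.2)
    F (c (deg p.1) (deg h)) (c (deg p.2) (deg h)).
Proof.
under eq_bigr => h _.
  rewrite -(sum_medge _ _ (fun i1 i2 => F (c i1 (deg h)) (c i2 (deg h)))) //.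
  over.
rewrite sumrMnl; congr (_ *+ 2).
rewrite -(sum_ndeg H _ (fun j => \sum_(i1 <- degrees G)
  \sum_(i2 <- degrees G | (i1 <= i2)%N) (medge G i1 i2)%:R * F (c i1 j) (c i2 j))).
apply: eq_bigr => j _; rewrite big_distrr; apply: eq_bigr => i1 _.
by rewrite big_distrr; apply: eq_bigr => i2 _; rewrite /= -mulrA.
Qed.

Lemma Mpoly_H2 :
  Mpoly_H G H *+ 2 = \sum_(g : G) \sum_(q : H * H | adj q.1 q.2)
    F (c (deg g) (deg q.1)) (c (deg g) (deg q.2)).
Proof.
under eq_bigr => g _.
  rewrite -(sum_medge _ _ (fun j1 j2 => F (c (deg g) j1) (c (deg g) j2))) //.
  over.
rewrite sumrMnl; congr (_ *+ 2).
rewrite -(sum_ndeg G _ (fun i => \sum_(j1 <- degrees H)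
  \sum_(j2 <- degrees H | (j1 <= j2)%N) (medge H j1 j2)%:R * F (c i j1) (c i j2))).
apply: eq_bigr => i _; rewrite big_distrr; apply: eq_bigr => j1 _.
by rewrite big_distrr; apply: eq_bigr => j2 _; rewrite /= -mulrA.
Qed.

(** Doubling for both factors gives 4 on the left. The two monomials are the two ways to match the
    ends of an edge of [G] with those of an edge of [H]; their sums over ordered pairs agree, whence
    the 2 on the right. *)
Lemma Mpoly_cross4 :
  Mpoly_cross G H *+ 2 *+ 2
  = (\sum_(p : G * G | adj p.1 p.2) \sum_(q : H * H | adj q.1 q.2)
      F (c (deg p.1) (deg q.1)) (c (deg p.2) (deg q.2))) *+ 2.
Proof.
(* The sum of both monomials is symmetric in [i1, i2] and in [j1, j2] separately, so [sum_medge]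
   applies once per factor. *)
pose D i1 i2 j1 j2 :=
  F (c i1 j1) (c i2 j2) + F (c i1 j2) (c i2 j1).
have D_symr i1 i2 j1 j2 : D i1 i2 j1 j2 = D i1 i2 j2 j1 by rewrite /D addrC.
have D_syml i1 i2 j1 j2 : D i1 i2 j1 j2 = D i2 i1 j1 j2.
  by rewrite /D addrC; congr (_ + _); rewrite F_sym.
pose S i1 i2 := \sum_(q : H * H | adj q.1 q.2) D i1 i2 (deg q.1) (deg q.2).
have S_sym i1 i2 : S i1 i2 = S i2 i1 by apply: eq_bigr => q _; rewrite D_syml.
transitivity (\sum_(p : G * G | adj p.1 p.2) S (deg p.1) (deg p.2)).
  rewrite -sum_medge //; congr (_ *+ 2).
  rewrite -sumrMnl; apply: eq_bigr => i1 _; rewrite -sumrMnl; apply: eq_bigr => i2 _.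
  rewrite /S -sum_medge // mulrnAr; congr (_ *+ 2).
  rewrite big_distrr; apply: eq_bigr => j1 _.
  by rewrite big_distrr; apply: eq_bigr => j2 _; rewrite /= -mulrA.
rewrite -sumrMnl; apply: eq_bigr => p _; rewrite /S big_split mulr2n /=.
congr (_ + _).
(* Reversing the ordered edge [q] turns the second monomial into the first. *)
exact: (big_adj_flip H _ (fun h h' =>
  F (c (deg p.1) (deg h)) (c (deg p.2) (deg h')))).
Qed.

End StrongProductMpoly.

Lemma mpoly_int_mulr2n_inj (n : nat) : injective (fun p : {mpoly int[n]} => p *+ 2).
Proof.
move=> p q /= /mpolyP E; apply/mpolyP => m.
by have := E m; rewrite !mcoeffMn => /eqP; rewrite Num.Theory.eqrMn2r // => /eqP.
Qed.

Theorem theorem3p3 (G H : sgraph) :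
  Mpoly (strong_product G H) = Mpoly_G G H + Mpoly_H G H + Mpoly_cross G H.
Proof.
apply: mpoly_int_mulr2n_inj; apply: mpoly_int_mulr2n_inj => /=.
rewrite (mulrnDl _ _ (Mpoly_cross G H)) (mulrnDl _ _ (Mpoly_H G H)).
(* After [Mpoly_cross4] every term carries the same outer factor 2, which is then removed, leaving
   the splitting of ordered adjacent pairs. *)
rewrite (mulrnDl _ _ (Mpoly_cross G H *+ 2)) Mpoly_cross4 -[RHS]mulrnDl.
rewrite Mpoly_G2 Mpoly_H2 Mpoly2; congr (_ *+ 2).
under eq_bigr => p _ do rewrite !deg_strong_product.
exact: (sum_strong_adj G H _ (fun g h g' h' =>
  vx ^+ minn (deg g + deg h + deg g * deg h) (deg g' + deg h' + deg g' * deg h')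
  * vy ^+ maxn (deg g + deg h + deg g * deg h) (deg g' + deg h' + deg g' * deg h'))).
Qed.
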